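(* Let $A_{\mathbb R}$ be a quiver of continuous type $A$ and $k$ a field. For every interval $I\subseteq\mathbb R$ the representation $M_I$ of $A_{\mathbb R}$ is indecomposable, and every pointwise one-dimensional indecomposable representation of $A_{\mathbb R}$ is isomorphic to $M_I$ for some interval $I\subseteq\mathbb R$. Moreover, if $V$ and $V'$ are pointwise one-dimensional indecomposable representations of $A_{\mathbb R}$, then $V\cong V'$ if and only if $\operatorname{supp}V=\operatorname{supp}V'$.
   Context: A quiver of continuous type $A$, $A_{\mathbb R}=(\mathbb R,S,\preceq)$: $S\subset\mathbb R$ is a discrete, possibly empty, subset with no accumulation points; $\bar S=S\cup\{\pm\infty\}$ with $-\infty<s<+\infty$ for $s\in S$. Elements of $\bar S$ are indexed in an order-preserving way by a subset of $\mathbb Z\cup\{\pm\infty\}$ such that the index $0$ is used, and if $m\le p\le n$ in $\mathbb Z\cup\{\pm\infty\}$ and the indices $m,n$ are used then so is $p$ (so neighbours in $\bar S$ have consecutive integer indices; if $S$ is bounded above, $+\infty$ has an integer index, otherwise $+\infty=s_{+\infty}$; similarly for $-\infty$). The partial order $\preceq$ on $\mathbb R$: $x\preceq y$ iff $x=y$ or there are consecutive $s_n,s_{n+1}\in\bar S$ with $s_n\le x,y\le s_{n+1}$ and [$x\le y$ if $n$ is even; $y\le x$ if $n$ is odd]. So $s_n$ is a sink for $n$ even and a source for $n$ odd. A representation $V$ of $A_{\mathbb R}$ over $k$ assigns to each $x\in\mathbb R$ a $k$-vector space $V(x)$ and to each pair $y\preceq x$ a linear map $V(x,y):V(x)\to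 V(y)$ with $V(x,x)=\mathrm{id}$ and $V(y,z)\circ V(x,y)=V(x,z)$ for $z\preceq y\preceq x$. Morphisms are families of linear maps $f(x):V(x)\to W(x)$ commuting with the structure maps. The support is $\operatorname{supp}V=\{x: V(x)\ne0\}$. $V$ is pointwise one-dimensional if $\dim V(x)\le 1$ for all $x$. Indecomposable representations are nonzero. An interval is a nonempty connected subset of $\mathbb R$. For an interval $I$, $M_I$ is given by $M_I(x)=k$ if $x\in I$ and $0$ otherwise; $M_I(x,y)=1_k$ if $y\preceq x$ and $x,y\in I$, and $0$ otherwise. *)

(* Defs.v *)
From HB Require Import structures.
From mathcomp Require Import all_boot all_order all_algebra.
From mathcomp Require Import zify.
From mathcomp Require Import all_classical all_reals all_analysis.
Import Order.TTheory GRing.Theory Num.Theory.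
Import numFieldNormedType.Exports.

Set Implicit Arguments.
Unset Strict Implicit.
Unset Printing Implicit Defensive.

Local Open Scope classical_set_scope.
Local Open Scope ring_scope.

Definition sbar (R : realType) (S : set R) : set (\bar R) :=
  EFin @` S `|` [set -oo; +oo]%E.

(** The indices live in Z u {-oo, +oo} = [\bar int]. The values of [node]
    outside [indices] are irrelevant. *)
Record quiver (R : realType) := Quiver {
  sinks_sources : set R;
  indices : set (\bar int);
  node : \bar int -> \bar R;
  sinks_sources_discrete : isolated sinks_sources = sinks_sources;
  sinks_sources_no_limit : limit_point sinks_sources = set0;
  indices0 : indices 0%:E;
  indices_convex : forall m p n : \bar int,
    indices m -> indices n -> (m <= p)%E -> (p <= n)%E -> indices p;
  node_image : node @` indices = sbar sinks_sources;
  node_mono : forall m n, indices m -> indices n ->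
    (node m <= node n)%E = (m <= n)%E }.

Definition prec (R : realType) (A : quiver R) (x y : R) : Prop :=
  x = y \/
  exists n : int,
    [/\ indices A n%:E, indices A (n + 1)%:E,
        (node A n%:E <= x%:E <= node A (n + 1)%:E)%E,
        (node A n%:E <= y%:E <= node A (n + 1)%:E)%E &
        if (2 %| n)%Z then x <= y else y <= x].

(** Distinct segments [s_n, s_(n+1)] meet at most in a shared endpoint. *)
Lemma segment_overlap (R : realType) (A : quiver R) (n m : int) (y : R) :
  indices A n%:E -> indices A (n + 1)%:E -> indices A m%:E -> indices A (m + 1)%:E ->
  (node A n%:E <= y%:E <= node A (n + 1)%:E)%E ->
  (node A m%:E <= y%:E <= node A (m + 1)%:E)%E ->
  [\/ n = m, m = n + 1 /\ y%:E = node A m%:E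
    | n = m + 1 /\ y%:E = node A n%:E].
Proof.
move=> n0 n1 m0 m1 /andP[an bn] /andP[am bm].
have mn : (m <= n + 1).
  by rewrite -lee_fin -(node_mono m0 n1); exact: le_trans am bn.
have nm : (n <= m + 1).
  by rewrite -lee_fin -(node_mono n0 m1); exact: le_trans an bm.
have [->|] : n = m \/ (m = n + 1 \/ n = m + 1) by lia.
  by constructor 1.
case=> e; [constructor 2|constructor 3]; split=> //; apply/eqP.
  by rewrite eq_le am e bn.
by rewrite eq_le an e bm.
Qed.

Lemma prec_chain (R : realType) (A : quiver R) (x y z : R) :
  prec A z y -> prec A y x ->
  [\/ z = y, y = x |
    exists n : int,
    [/\ indices A n%:E, indices A (n + 1)%:E,
        (node A n%:E <= z%:E <= node A (n + 1)%:E)%E,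
        (node A n%:E <= x%:E <= node A (n + 1)%:E)%E &
        if (2 %| n)%Z then z <= y <= x else x <= y <= z]].
Proof.
case=> [->|[n [n0 n1 zn yn hn]]]; first by constructor 1.
case=> [->|[m [m0 m1 ym xm hm]]]; first by constructor 2.
case: (segment_overlap n0 n1 m0 m1 yn ym) => [e|[e ye]|[e ye]].
- constructor 3; exists n; rewrite -e in hm xm; split=> //.
  by move: hn hm; case: ifP => _ -> ->.
- have [n2|n2] := boolP (2 %| n)%Z.
    have m2 : (2 %| m)%Z = false by lia.
    rewrite m2 in hm; constructor 2; apply/eqP; rewrite eq_le hm andbT.
    by rewrite -lee_fin ye; case/andP: xm.
  rewrite (negbTE n2) in hn; constructor 1; apply/eqP; rewrite eq_le hn andbT.
  by rewrite -lee_fin ye e; case/andP: zn.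
- have [n2|n2] := boolP (2 %| n)%Z.
    rewrite n2 in hn; constructor 1; apply/eqP; rewrite eq_le hn /=.
    by rewrite -lee_fin ye; case/andP: zn.
  have m2 : (2 %| m)%Z by lia.
  rewrite m2 in hm; constructor 2; apply/eqP; rewrite eq_le hm /=.
  by rewrite -lee_fin ye e; case/andP: xm.
Qed.

Lemma prec_between (R : realType) (A : quiver R) (x y z : R) :
  prec A z y -> prec A y x -> (z <= y <= x) \/ (x <= y <= z).
Proof.
move=> zy yx; case: (prec_chain zy yx) => [->|->|[n [_ _ _ _]]].
- by rewrite lexx /= andbT; case: (leP y x) => [|/ltW]; [left|right].
- by rewrite lexx /= andbT; case: (leP z x) => [|/ltW]; [left|right].
- by case: ifP => _; [left|right].
Qed.

Lemma prec_refl (R : realType) (A : quiver R) (x : R) : prec A x x.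
Proof. by left. Qed.

Lemma prec_trans (R : realType) (A : quiver R) (x y z : R) :
  prec A z y -> prec A y x -> prec A z x.
Proof.
move=> zy yx; case: (prec_chain zy yx) => [->//|<-//|[n [n0 n1 zn xn h]]].
right; exists n; split=> //; move: h.
by case: ifP => _ /andP[]; exact: le_trans.
Qed.

Lemma prec_antisym (R : realType) (A : quiver R) (x y : R) :
  prec A x y -> prec A y x -> x = y.
Proof.
move=> xy yx; case: (prec_between xy yx) => /andP[h1 h2];
  by apply/eqP; rewrite eq_le h1 h2.
Qed.

(** [rep_map] goes from [x] to [y] when [y] precedes [x]; its independence of
    the proof follows from [rep_map_id] and [rep_map_comp]. *)
Record rep (R : realType) (A : quiver R) (k : fieldType) := Rep {
  rep_space :> R -> lmodType k;
  rep_map : forall x y : R, prec A y x ->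
    {linear rep_space x -> rep_space y};
  rep_map_id : forall (x : R) (xx : prec A x x) (v : rep_space x),
    rep_map xx v = v;
  rep_map_comp : forall (x y z : R)
    (yx : prec A y x) (zy : prec A z y) (zx : prec A z x) (v : rep_space x),
    rep_map zy (rep_map yx v) = rep_map zx v }.

Record rep_hom (R : realType) (A : quiver R) (k : fieldType) (V W : rep A k) :=
  RepHom {
  hom_map :> forall x : R, {linear V x -> W x};
  hom_map_natural : forall (x y : R) (yx : prec A y x) (v : V x),
    hom_map y (rep_map V yx v) = rep_map W yx (hom_map x v) }.

Definition rep_iso (R : realType) (A : quiver R) (k : fieldType)
    (V W : rep A k) : Prop :=
  exists (f : rep_hom V W) (g : rep_hom W V),
    forall x : R, cancel (f x) (g x) /\ cancel (g x) (f x).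

Definition supp (R : realType) (A : quiver R) (k : fieldType) (V : rep A k) :
  set R := [set x | exists v : V x, v != 0].

Definition rep_zero (R : realType) (A : quiver R) (k : fieldType)
  (V : rep A k) : Prop := forall (x : R) (v : V x), v = 0.

(** [dim U <= n], for [U] of possibly infinite dimension. *)
Definition dim_le (k : fieldType) (n : nat) (U : lmodType k) : Prop :=
  exists e : 'I_n -> U, forall u : U, exists c : 'I_n -> k,
    u = \sum_(i < n) c i *: e i.

Definition pointwise_one_dim (R : realType) (A : quiver R) (k : fieldType)
  (V : rep A k) : Prop := forall x : R, dim_le 1 (V x).

Definition pair_map (k : fieldType) (U1 U2 W1 W2 : lmodType k)
  (f : {linear U1 -> W1}) (g : {linear U2 -> W2}) (u : (U1 * U2)%type) :
  (W1 * W2)%type := (f u.1, g u.2).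

Lemma pair_map_linear (k : fieldType) (U1 U2 W1 W2 : lmodType k)
  (f : {linear U1 -> W1}) (g : {linear U2 -> W2}) : linear (pair_map f g).
Proof. by move=> a u v; rewrite /pair_map /= !linearP. Qed.

HB.instance Definition _ (k : fieldType) (U1 U2 W1 W2 : lmodType k)
  (f : {linear U1 -> W1}) (g : {linear U2 -> W2}) :=
  GRing.isLinear.Build k (U1 * U2)%type (W1 * W2)%type *:%R
    (pair_map f g) (pair_map_linear f g).

Definition rep_sum (R : realType) (A : quiver R) (k : fieldType)
  (V W : rep A k) : rep A k.
Proof.
refine (@Rep R A k (fun x => (V x * W x)%type : lmodType k)
  (fun x y yx => pair_map (rep_map V yx) (rep_map W yx)) _ _).
- by move=> x xx [v w]; rewrite /= /pair_map /= !rep_map_id.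
- by move=> x y z yx zy zx [v w]; rewrite /= /pair_map /= !(rep_map_comp _ _ zx).
Defined.

Definition indecomposable (R : realType) (A : quiver R) (k : fieldType)
    (V : rep A k) : Prop :=
  ~ rep_zero V /\
  forall V1 V2 : rep A k, rep_iso V (rep_sum V1 V2) ->
    rep_zero V1 \/ rep_zero V2.

Definition real_interval (R : realType) (I : set R) : Prop :=
  I !=set0 /\ connected I.

Definition indic_space (k : fieldType) (b : bool) : lmodType k :=
  if b then (k^o : lmodType k) else ('rV[k]_0 : lmodType k).

Definition indic_map (k : fieldType) (b c : bool) :
    {linear indic_space k b -> indic_space k c} :=
  match b, c with
  | true, true => (idfun : {linear k^o -> k^o})
  | _, _ => (\0 : {linear _ -> _})
  end.

Lemma real_interval_prec (R : realType) (A : quiver R) (I : set R)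
    (hI : real_interval I) (x y z : R) :
  prec A z y -> prec A y x -> x \in I -> z \in I -> y \in I.
Proof.
move=> zy yx /set_mem Ix /set_mem Iz; apply/mem_set.
case: hI => _ /connected_intervalP cI.
by case: (prec_between zy yx); [exact: cI Iz Ix y|exact: cI Ix Iz y].
Qed.

Definition interval_rep (R : realType) (A : quiver R) (k : fieldType)
  (I : set R) (hI : real_interval I) : rep A k.
Proof.
refine (@Rep R A k (fun x => indic_space k (x \in I))
  (fun x y _ => indic_map k (x \in I) (y \in I)) _ _).
- move=> x _; case: (x \in I) => //= v.
  by rewrite [RHS]thinmx0.
- move=> x y z yx zy _; move: (real_interval_prec hI zy yx).
  case: (x \in I); case: (z \in I); case: (y \in I) => //= h v;
    by have := h isT isT.
Defined.

(* Main.v *)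
(** Call a choice of vectors [f x] in [V x], compatible with the structure maps
    on its support and with convex support, a partial section. By Zorn's lemma
    [V] has a maximal one. If a structure map between a point of its support and
    a point outside were nonzero, it would be nonzero on the whole segment
    between them, and the section could be prolonged. So [V] splits as its
    restrictions to the support and to the complement; when [V] is
    indecomposable, the section spans it, and [V] is determined by an interval.

    Conversely, if such a spanning section exists and [V] is isomorphic to
    [V1 (+) V2], at each point of the support exactly one [Vi] is nonzero. Which
    one is the same at comparable points, and every real number has a
    neighbourhood of points comparable to it, so connectedness concludes. *)
From HB Require Import structures.
Require Import Defs.
From mathcomp Require Import all_boot all_order all_algebra.
From mathcomp Require Import zify lra.
From mathcomp Require Import all_classical all_reals all_analysis.
Import Order.TTheory GRing.Theory Num.Theory.
Import numFieldNormedType.Exports.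

Set Implicit Arguments.
Unset Strict Implicit.
Unset Printing Implicit Defensive.

Local Open Scope classical_set_scope.
Local Open Scope ring_scope.

(** * Unoriented betweenness and convex subsets of the line *)

Definition btw (R : realType) (x y z : R) : Prop := x <= y <= z \/ z <= y <= x.

Lemma btw_total (R : realType) (x y z : R) :
  [\/ btw y x z, btw x y z | btw x z y].
Proof.
rewrite /btw; case: (lerP x y); case: (lerP y z); case: (lerP x z) => h1 h2 h3;
  try (by constructor 1; lra); try (by constructor 2; lra);
  by constructor 3; lra.
Qed.

(** Distinct comparable points share a segment between consecutive nodes, on which [prec] is the
    usual order or its reverse; a point between them lies in that segment too. *)
Lemma prec_btw (R : realType) (A : quiver R) (x y z : R) :
  btw x y z -> prec A z x -> prec A z y /\ prec A y x.
Proof.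
move=> xyz [zx|[n [n0 n1 /andP[zl zr] /andP[xl xr] h]]].
  have -> : y = x by apply/eqP; rewrite eq_le; case: xyz; lra.
  by rewrite zx; split; left.
have yn : (node A n%:E <= y%:E <= node A (n + 1)%:E)%E.
  case: xyz => /andP[a b]; rewrite -!lee_fin in a b; apply/andP; split.
  - exact: le_trans a.
  - exact: le_trans zr.
  - exact: le_trans a.
  - exact: le_trans xr.
split; right; exists n; split=> //; rewrite ?zl ?xl //; move: h xyz;
  by rewrite /btw; case: ifP; lra.
Qed.

Definition btw_closed (R : realType) (J : set R) : Prop :=
  forall x y z, J x -> J z -> btw x y z -> J y.

Lemma btw_closed_interval (R : realType) (J : set R) :
  btw_closed J <-> is_interval J.
Proof.
split=> [cJ x z Jx Jz y xyz|cJ x y z Jx Jz [] h].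
- by apply: (cJ x y z) => //; left.
- exact: (cJ x z).
- exact: (cJ z x).
Qed.

(** A point between [x] in [J] and [z] in [K] lies either between [x] and [a] or between [a] and
    [z]. *)
Lemma btw_closedU (R : realType) (J K : set R) (a : R) :
  btw_closed J -> btw_closed K -> J a -> K a -> btw_closed (J `|` K).
Proof.
move=> cJ cK Ja Ka.
have H x y z : J x -> K z -> btw x y z -> (J `|` K) y.
  move=> Jx Kz xyz.
  have [h|h] : btw x y a \/ btw a y z.
    by move: xyz; rewrite /btw; case: (lerP y a); lra.
  - by left; exact: cJ Jx Ja h.
  - by right; exact: cK Ka Kz h.
move=> x y z [Jx|Kx] [Jz|Kz] xyz.
- by left; exact: cJ Jx Jz xyz.
- exact: H Jx Kz xyz.
- by apply: H Jz Kx _; move: xyz; rewrite /btw; lra.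
- by right; exact: cK Kx Kz xyz.
Qed.

(** * Partial sections: gluing, prolongation, maximality *)

Lemma rep_map_irr (R : realType) (A : quiver R) (k : fieldType) (V : rep A k)
  (x y : R) (p q : prec A y x) (v : V x) : rep_map V p v = rep_map V q v.
Proof. by rewrite (Prop_irrelevance p q). Qed.

Definition compat (R : realType) (A : quiver R) (k : fieldType) (V : rep A k)
  (f : forall x, V x) : Prop :=
  forall x y (yx : prec A y x), f x != 0 -> f y != 0 -> rep_map V yx (f x) = f y.

(** The domain of a partial section is encoded as the set where it is nonzero. *)
Definition partial_section (R : realType) (A : quiver R) (k : fieldType)
    (V : rep A k) (f : forall x, V x) : Prop :=
  btw_closed [set x | f x != 0] /\ compat f.

Definition extends (R : realType) (A : quiver R) (k : fieldType) (V : rep A k)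
  (f g : forall x, V x) : Prop := forall x, f x != 0 -> g x = f x.

(** A relation between points [x] and [y] lying each in only one of the two
    supports factors through [a], since convexity forces [a] between them. *)
Lemma section_glue (R : realType) (A : quiver R) (k : fieldType) (V : rep A k)
    (f h : forall x, V x) (a : R) :
  partial_section f -> partial_section h -> f a != 0 -> h a != 0 ->
  (forall x, f x != 0 -> h x != 0 -> f x = h x) ->
  exists g, [/\ partial_section g, extends f g & extends h g].
Proof.
move=> [fJ fc] [hK hc] fa ha fh.
pose g x := if f x == 0 then h x else f x.
have fg : extends f g by move=> x fx; rewrite /g (negbTE fx).
have hg : extends h g by move=> x hx; rewrite /g; case: eqP => // /eqP fx; exact: fh.
have gE x : g x != 0 -> f x != 0 \/ h x != 0.
  by rewrite /g; have [_ hx|fx _] := eqVneq (f x) 0; [right|left].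
clearbody g.
exists g; split=> //; split.
  suff -> : [set x | g x != 0] = [set x | f x != 0] `|` [set x | h x != 0].
    exact: btw_closedU fa ha.
  apply/seteqP; split=> x /=; first exact: gE.
  case=> [fx|hx]; [rewrite fg|rewrite hg]; assumption.
move=> x y yx gx gy.
have [/andP[fx fy]|fxy] := boolP ((f x != 0) && (f y != 0)); first by rewrite !fg // fc.
have [/andP[hx hy]|hxy] := boolP ((h x != 0) && (h y != 0)); first by rewrite !hg // hc.
have [ya ax] : prec A y a /\ prec A a x.
  apply: prec_btw yx.
  case: (gE _ gx) fxy hxy => nx; case: (gE _ gy) => ny; rewrite nx ny /= ?andbT //
    => nf nh; case: (btw_total a x y) => // xay.
  - by rewrite (hK a x y ha ny xay) in nh.
  - by rewrite (fJ a y x fa nx xay) in nf.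
  - by rewrite (fJ a x y fa ny xay) in nf.
  - by rewrite (hK a y x ha nx xay) in nh.
rewrite -(rep_map_comp ax ya yx).
have -> : rep_map V ax (g x) = g a.
  by case: (gE _ gx) => nx; [rewrite !fg // fc|rewrite !hg // hc].
by case: (gE _ gy) => ny; [rewrite !fg // fc|rewrite !hg // hc].
Qed.

(** The section pushes [u] forward to every [z] between [b] and [a]. No image vanishes, because the
    map from [a] to [b] factors through [z]. *)
Lemma section_segment (R : realType) (A : quiver R) (k : fieldType) (V : rep A k)
    (a b : R) (ba : prec A b a) (u : V a) : rep_map V ba u != 0 ->
  exists h, [/\ partial_section h,
    forall z, h z != 0 -> prec A b z /\ prec A z a &
    forall z (za : prec A z a), prec A b z -> h z = rep_map V za u /\ h z != 0].
Proof.
move=> ub0.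
(* A structure map takes a proof of comparability, hence the case distinction; the default 0 keeps
   all other points out of the support. *)
pose h z := match pselect (prec A b z /\ prec A z a) with
  | left p => rep_map V (proj2 p) u | right _ => 0 end.
have hE z (za : prec A z a) : prec A b z -> h z = rep_map V za u.
  by rewrite /h; case: pselect => [p _|np ?]; [exact: rep_map_irr|case: np; split].
have h0 z : h z != 0 -> prec A b z /\ prec A z a.
  by rewrite /h; case: pselect => // _; rewrite eqxx.
have hn0 z (za : prec A z a) : prec A b z -> h z != 0.
  move=> bz; rewrite (hE z za bz); apply: contraNneq ub0 => e.
  by rewrite -(rep_map_comp za bz ba) e linear0.
exists h; split=> //; last by move=> z za bz; split; [exact: hE|exact: hn0 za bz].
split=> [x y z /= /h0[bx xa] /h0[bz za] xyz|x y yx /h0[bx xa] /h0[by_ ya]].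
  have aby : btw a y b.
    by move: (prec_between bx xa) (prec_between bz za) xyz; rewrite /btw; lra.
  by have [? ?] := prec_btw aby ba; exact: hn0.
by rewrite (hE x xa bx) (hE y ya by_) (rep_map_comp xa yx ya).
Qed.

Lemma dim_le1_gen (k : fieldType) (U : lmodType k) (u : U) :
  dim_le 1 U -> u != 0 -> forall v, exists c, v = c *: u.
Proof.
case=> e he u0 v; have [c] := he u; have [d] := he v; rewrite !big_ord1 => -> uE.
have c0 : c ord0 != 0 by apply: contraNneq u0 => c0; rewrite uE c0 scale0r.
by exists (d ord0 / c ord0); rewrite uE scalerA divfK.
Qed.

(** [f] is glued at [a] with the push-forward of [f a] towards [b]; the two agree where both are
    nonzero by compatibility of [f]. *)
Lemma extend_down (R : realType) (A : quiver R) (k : fieldType) (V : rep A k)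
    (f : forall x, V x) (a b : R) (ba : prec A b a) :
  partial_section f -> f a != 0 -> rep_map V ba (f a) != 0 ->
  exists g, [/\ partial_section g, extends f g & g b != 0].
Proof.
move=> sf fa0 /section_segment[h [sh hK hE]].
have [ha ha0] := hE a (prec_refl A a) ba; rewrite rep_map_id in ha.
have [|g [sg fg hg]] := section_glue sf sh fa0 ha0.
  move=> x fx0 /hK[bx xa]; have [-> _] := hE x xa bx; by rewrite sf.2.
exists g; split=> //; have [_ hb0] := hE b ba (prec_refl A b).
by rewrite hg.
Qed.

(** The structure map now enters the support of [f]. In dimension one [u] can be rescaled to have
    image [f a] at [a], and its push-forward from [b] is then glued with [f] at [a]. *)
Lemma extend_up (R : realType) (A : quiver R) (k : fieldType) (V : rep A k)
    (f : forall x, V x) (a b : R) (ab : prec A a b) (u : V b) :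
  pointwise_one_dim V ->
  partial_section f -> f a != 0 -> rep_map V ab u != 0 ->
  exists g, [/\ partial_section g, extends f g & g b != 0].
Proof.
move=> V1 sf fa0 u0; have [c uE] := dim_le1_gen (V1 a) u0 (f a).
have {}uE : rep_map V ab (c *: u) = f a by rewrite linearZ.
have := fa0; rewrite -uE => /section_segment[h [sh hK hE]].
have [ha ha0] := hE a ab (prec_refl A a); rewrite uE in ha.
have [|g [sg fg hg]] := section_glue sf sh fa0 ha0.
  move=> x fx0 /hK[ax xb]; have [-> _] := hE x xb ax.
  have cu0 : rep_map V xb (c *: u) != 0.
    by apply: contraNneq fa0 => e; rewrite -uE -(rep_map_comp xb ax ab) e linear0.
  (* Compatibility only compares images at [a]. As [f x] is [d] times the image of [c *: u] and both
     are sent to [f a], which is nonzero, [d] is 1. *)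
  have [d fE] := dim_le1_gen (V1 x) cu0 (f x).
  have := sf.2 _ _ ax fx0 fa0; rewrite fE linearZ /= (rep_map_comp xb ax ab) uE.
  rewrite -[RHS]scale1r => /eqP; rewrite -subr_eq0 -scalerBl scaler_eq0.
  by rewrite (negbTE fa0) orbF subr_eq0 => /eqP ->; rewrite scale1r.
exists g; split=> //; have [_ hb0] := hE b (prec_refl A b) ab.
by rewrite hg.
Qed.

(** Zorn's lemma for the preorder [extends], starting from the zero section, whose domain is empty;
    a chain is bounded by its union. *)
Lemma maximal_section (R : realType) (A : quiver R) (k : fieldType) (V : rep A k) :
  exists2 f : forall x, V x, partial_section f &
    forall g, partial_section g -> extends f g -> extends g f.
Proof.
pose T := {f : forall x, V x | partial_section f}.
pose leT (f g : T) := `[< extends (sval f) (sval g) >].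
have s0 : partial_section (fun x => 0 : V x).
  by split=> [x y z /=|x y yx]; rewrite eqxx.
have leT_refl f : leT f f by apply/asboolP.
have leT_trans f g h : leT f g -> leT g h -> leT f h.
  move=> /asboolP fg /asboolP gh; apply/asboolP => x fx.
  by rewrite gh fg.
have [|f fmax] := ZL_preorder (exist _ _ s0) leT_refl leT_trans; last first.
  exists (sval f) => [|g sg fg]; first exact: svalP.
  have /fmax/asboolP : leT f (exist _ g sg) by apply/asboolP.
  exact.
move=> C totC.
(* The union of the chain: any member that is nonzero at [x] may be chosen, since members of a chain
   agree where both are nonzero. *)
pose g x := match pselect (exists s, C s /\ sval s x != 0) with
  | left p => sval (projT1 (cid p)) x | right _ => 0 end.
have gE s x : C s -> sval s x != 0 -> g x = sval s x.
  move=> Cs sx; rewrite /g; case: pselect => [p|[]]; last by exists s.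
  case: cid => t /= [Ct tx].
  by have [/asboolP ts|/asboolP st] := totC _ _ Ct Cs; [rewrite ts|rewrite st].
have gN x : g x != 0 -> exists s, C s /\ sval s x != 0.
  by rewrite /g; case: pselect => //; rewrite eqxx.
(* Convexity and compatibility involve two points at a time, and by totality one member of the chain
   covers both. *)
have g2 x y : g x != 0 -> g y != 0 -> exists s, [/\ C s, sval s x != 0 & sval s y != 0].
  move=> /gN[s [Cs sx]] /gN[t [Ct ty]].
  have [/asboolP st|/asboolP ts] := totC _ _ Cs Ct.
  - by exists t; split=> //; rewrite st.
  - by exists s; split=> //; rewrite ts.
have sg : partial_section g.
  split=> [x y z /= gx gz xyz|x y yx gx gy].
  - have [s [Cs sx sz]] := g2 _ _ gx gz.
    have sy : sval s y != 0 by exact: (svalP s).1 sx sz xyz.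
    by rewrite (gE s).
  - have [s [Cs sx sy]] := g2 _ _ gx gy.
    by rewrite !(gE s) //; apply: (svalP s).2.
by exists (exist _ g sg) => s Cs; apply/asboolP => x; exact: gE.
Qed.

(** * Splitting a representation along a subset of the line *)

Definition cut_space (k : fieldType) (U : lmodType k) (b : bool) : lmodType k :=
  if b then U else ('rV[k]_0 : lmodType k).

Definition cut_proj (k : fieldType) (U : lmodType k) (b : bool) :
    {linear U -> cut_space U b} :=
  if b return {linear U -> cut_space U b} then (idfun : {linear U -> U})
  else (\0 : {linear _ -> _}).

Definition cut_inj (k : fieldType) (U : lmodType k) (b : bool) :
    {linear cut_space U b -> U} :=
  if b return {linear cut_space U b -> U} then (idfun : {linear U -> U})
  else (\0 : {linear _ -> _}).

Lemma cut_projK (k : fieldType) (U : lmodType k) (b : bool) (v : cut_space U b) :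
  cut_proj U b (cut_inj U b v) = v.
Proof. by case: b v => // v; rewrite [RHS]thinmx0. Qed.

Lemma cut_injK (k : fieldType) (U : lmodType k) (b : bool) (v : U) :
  cut_inj U b (cut_proj U b v) = if b then v else 0.
Proof. by case: b. Qed.

Lemma cut_proj_false (k : fieldType) (U : lmodType k) (b : bool) (v : U) :
  ~~ b -> cut_proj U b v = 0.
Proof. by case: b. Qed.

Lemma cut_inj_false (k : fieldType) (U : lmodType k) (b : bool) (v : cut_space U b) :
  ~~ b -> cut_inj U b v = 0.
Proof. by case: b v. Qed.

Definition splits (R : realType) (A : quiver R) (k : fieldType) (V : rep A k)
  (P : R -> bool) : Prop :=
  forall x y (yx : prec A y x) (v : V x), P x != P y -> rep_map V yx v = 0.

Definition cut (R : realType) (A : quiver R) (k : fieldType) (V : rep A k)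
  (P : R -> bool) (hP : splits V P) : rep A k.
Proof.
refine (@Rep R A k (fun x => cut_space (V x) (P x))
  (fun x y yx => cut_proj (V y) (P y) \o rep_map V yx \o cut_inj (V x) (P x)
     : {linear _ -> _}) _ _).
- by move=> x xx v /=; rewrite rep_map_id cut_projK.
- move=> x y z yx zy zx v /=; rewrite cut_injK -(rep_map_comp yx zy zx).
  (* With [y] cut out, the composite through [y] must vanish: either [x] is kept and [hP] kills the
     map from [x] to [y], or [x] is cut out as well. *)
  case: ifPn => // Py; rewrite !linear0.
  have /orP[Px|Px] := orbN (P x); last by rewrite cut_inj_false // !linear0.
  by rewrite (hP x y) ?linear0 // Px (negbTE Py).
Defined.

Lemma splitsC (R : realType) (A : quiver R) (k : fieldType) (V : rep A k)
  (P : R -> bool) : splits V P -> splits V (fun x => ~~ P x).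
Proof. by move=> hP x y yx v; rewrite (inj_eq negb_inj); exact: hP. Qed.

Lemma cut_proj_natural (R : realType) (A : quiver R) (k : fieldType) (V : rep A k)
    (P : R -> bool) (hP : splits V P) (x y : R) (yx : prec A y x) (v : V x) :
  cut_proj (V y) (P y) (rep_map V yx v) =
  rep_map (cut hP) yx (cut_proj (V x) (P x) v).
Proof.
rewrite /= cut_injK; case: ifPn => // Px; rewrite !linear0.
have /orP[Py|Py] := orbN (P y); last exact: cut_proj_false.
by rewrite (hP x y) ?linear0 // Py (negbTE Px).
Qed.

Lemma cut_inj_natural (R : realType) (A : quiver R) (k : fieldType) (V : rep A k)
    (P : R -> bool) (hP : splits V P) (x y : R) (yx : prec A y x) (v : cut hP x) :
  cut_inj (V y) (P y) (rep_map (cut hP) yx v) =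
  rep_map V yx (cut_inj (V x) (P x) v).
Proof.
rewrite /= cut_injK; case: ifPn => // Py.
have /orP[Px|Px] := orbN (P x); last by rewrite cut_inj_false // linear0.
by rewrite hP // Px (negbTE Py).
Qed.

Definition split_map (k : fieldType) (U W1 W2 : lmodType k)
  (f : {linear U -> W1}) (g : {linear U -> W2}) (u : U) : (W1 * W2)%type := (f u, g u).

Lemma split_map_linear (k : fieldType) (U W1 W2 : lmodType k)
  (f : {linear U -> W1}) (g : {linear U -> W2}) : linear (split_map f g).
Proof. by move=> a u v; rewrite /split_map !linearP. Qed.

HB.instance Definition _ (k : fieldType) (U W1 W2 : lmodType k)
  (f : {linear U -> W1}) (g : {linear U -> W2}) :=
  GRing.isLinear.Build k U (W1 * W2)%type *:%R (split_map f g) (split_map_linear f g).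

Definition merge_map (k : fieldType) (U1 U2 W : lmodType k)
  (f : {linear U1 -> W}) (g : {linear U2 -> W}) (u : (U1 * U2)%type) : W := f u.1 + g u.2.

Lemma merge_map_linear (k : fieldType) (U1 U2 W : lmodType k)
  (f : {linear U1 -> W}) (g : {linear U2 -> W}) : linear (merge_map f g).
Proof. by move=> a u v; rewrite /merge_map /= !linearP scalerDr addrACA. Qed.

HB.instance Definition _ (k : fieldType) (U1 U2 W : lmodType k)
  (f : {linear U1 -> W}) (g : {linear U2 -> W}) :=
  GRing.isLinear.Build k (U1 * U2)%type W *:%R (merge_map f g) (merge_map_linear f g).

(** The vanishing of all maps between [P] and its complement makes the projections and injections
    natural. At each point one summand is [V x] and the other is zero. *)
Lemma cut_iso (R : realType) (A : quiver R) (k : fieldType) (V : rep A k)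
    (P : R -> bool) (hP : splits V P) :
  rep_iso V (rep_sum (cut hP) (cut (splitsC hP))).
Proof.
pose W := rep_sum (cut hP) (cut (splitsC hP)).
pose p x : {linear V x -> W x} :=
  split_map (cut_proj (V x) (P x)) (cut_proj (V x) (~~ P x)).
pose i x : {linear W x -> V x} :=
  merge_map (cut_inj (V x) (P x)) (cut_inj (V x) (~~ P x)).
have pN x y (yx : prec A y x) v : p y (rep_map V yx v) = rep_map W yx (p x v).
  by congr pair; [exact: (cut_proj_natural hP)|exact: (cut_proj_natural (splitsC hP))].
have iN x y (yx : prec A y x) v : i y (rep_map W yx v) = rep_map V yx (i x v).
  rewrite [RHS]linearD; apply: (f_equal2 +%R).
  - exact: (cut_inj_natural (hP := hP) yx v.1).
  - exact: (cut_inj_natural (hP := splitsC hP) yx v.2).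
exists (RepHom pN), (RepHom iN) => x; split=> [v|[v w]] /=.
- by rewrite /merge_map /= !cut_injK; case: (P x); rewrite ?addr0 ?add0r.
- rewrite /split_map /merge_map /= !linearD !cut_projK /=; congr pair; move: v w => /=.
  by case: (P x) => /= v w; [rewrite addr0|rewrite !thinmx0].
  by case: (P x) => /= v w; [rewrite !thinmx0|rewrite add0r].
Qed.

Lemma rep_zero_cut (R : realType) (A : quiver R) (k : fieldType) (V : rep A k)
    (P : R -> bool) (hP : splits V P) (x : R) (v : V x) :
  rep_zero (cut hP) -> P x -> v = 0.
Proof.
move=> z Px; transitivity (cut_inj (V x) (P x) (cut_proj (V x) (P x) v)).
  by rewrite cut_injK Px.
by rewrite (z x (cut_proj (V x) (P x) v)); exact: linear0.
Qed.

(** * Representations spanned by a compatible family of vectors *)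

Definition generator (R : realType) (A : quiver R) (k : fieldType) (V : rep A k)
  (f : forall x, V x) : Prop :=
  compat f /\ forall x (v : V x), exists c, v = c *: f x.

Lemma indecomposable_generator (R : realType) (A : quiver R) (k : fieldType)
    (V : rep A k) : pointwise_one_dim V -> indecomposable V ->
  exists2 f : forall x, V x, partial_section f & generator f.
Proof.
move=> V1 [Vn0 Vind]; have [f sf fmax] := maximal_section V.
(* By maximality, a prolongation of [f] cannot reach a point outside the support of [f]. *)
have fext b g : partial_section g -> extends f g -> g b != 0 -> f b != 0.
  by move=> sg fg gb; rewrite (fmax g sg fg b gb).
have fsplit : splits V (fun x => f x != 0).
  move=> x y yx v; have [fx|fx] := boolP (f x != 0); have [fy|fy] := boolP (f y != 0) => // _.
  (* A nonzero map leaving the support would prolong [f] downwards; one entering it would prolong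
     [f] upwards. *)
  - have [c ->] := dim_le1_gen (V1 x) fx v; rewrite linearZ /=.
    apply: contraNeq fy; rewrite scaler_eq0 negb_or => /andP[_].
    by case/(extend_down sf fx) => g [sg fg gy]; exact: fext sg fg gy.
  - apply: contraNeq fx; case/(extend_up V1 sf fy) => g [sg fg gx].
    exact: fext sg fg gx.
have fn0 : exists x, f x != 0.
  apply: contrapT => f0; apply: Vn0 => x v; apply/eqP; apply: contrapT => /negP v0.
  (* With both endpoints equal to [x], [section_segment] turns [v] into a section supported at [x],
     which extends the zero section vacuously. *)
  have := v0; rewrite -{1}(rep_map_id (prec_refl A x) v).
  case/section_segment => h [sh _ /(_ x (prec_refl A x) (prec_refl A x))[_ hx]].
  by apply: (f0); exists x; apply: fext sh _ hx => y fy; case: f0; exists y.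
exists f => //; split=> [|x v]; first exact: sf.2.
have [fx0|fx0] := eqVneq (f x) 0; last exact: dim_le1_gen (V1 x) fx0 v.
(* The summand on the support of [f] contains a nonzero [f y], so the complementary one is zero, and
   [v] lives there. *)
exists 0; rewrite scale0r; case: (Vind _ _ (cut_iso fsplit)) => z.
  by have [y fy] := fn0; move: (fy); rewrite (rep_zero_cut (f y) z fy) eqxx.
by apply: (rep_zero_cut v z); rewrite fx0 eqxx.
Qed.

(** If [u] is nonzero, coefficients along [u] are unique, so sending [u] to [w] defines a linear
    map; if [u] is 0, so is [w], and the zero map serves. *)
Lemma line_map (k : fieldType) (U W : lmodType k) (u : U) (w : W) :
  (forall v, exists c, v = c *: u) -> (u = 0 -> w = 0) ->
  exists f : {linear U -> W}, forall a, f (a *: u) = a *: w.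
Proof.
move=> gu uw; have [u0|u0] := eqVneq u 0.
  by exists (\0 : {linear U -> W}) => a; rewrite uw // scaler0.
pose f v := projT1 (cid (gu v)) *: w.
have fE a : f (a *: u) = a *: w.
  rewrite /f; case: cid => c /= /eqP.
  by rewrite -subr_eq0 -scalerBl scaler_eq0 (negbTE u0) orbF subr_eq0 => /eqP ->.
have flin : linear f.
  move=> a v1 v2; have [c1 ->] := gu v1; have [c2 ->] := gu v2.
  by rewrite scalerA -scalerDl !fE scalerDl scalerA.
pose F := GRing.isLinear.Build k U W *:%R f flin.
pose G : {linear U -> W} := HB.pack f F.
by exists G.
Qed.

Lemma generator_hom (R : realType) (A : quiver R) (k : fieldType) (V W : rep A k)
    (f : forall x, V x) (g : forall x, W x) : generator f -> generator g ->
  (forall x, (f x == 0) = (g x == 0)) ->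
  exists F : rep_hom V W, forall x a, F x (a *: f x) = a *: g x.
Proof.
move=> [fc fg] [gc gg] fgE.
have H x : exists F : {linear V x -> W x}, forall a, F (a *: f x) = a *: g x.
  by apply: line_map (fg x) _ => /eqP; rewrite fgE => /eqP.
pose F x := projT1 (cid (H x)).
have FE x a : F x (a *: f x) = a *: g x by rewrite /F; case: cid.
have FN x y (yx : prec A y x) v : F y (rep_map V yx v) = rep_map W yx (F x v).
  have [a ->] := fg x v; rewrite FE !linearZ /=.
  have [fx0|fx0] := eqVneq (f x) 0.
    have /eqP gx0 : g x == 0 by rewrite -fgE fx0.
    by rewrite fx0 gx0 !linear0.
  (* [compat] says nothing when [f y] is 0, but then [V y] and [W y] are both spanned by zero. *)
  have [fy0|fy0] := eqVneq (f y) 0.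
    have /eqP gy0 : g y == 0 by rewrite -fgE fy0.
    have [b ->] := fg y (rep_map V yx (f x)); have [c ->] := gg y (rep_map W yx (g x)).
    by rewrite fy0 gy0 !scaler0 linear0 scaler0.
  by rewrite fc // gc -?fgE // -[f y]scale1r FE scale1r.
by exists (RepHom FN).
Qed.

Lemma generator_iso (R : realType) (A : quiver R) (k : fieldType) (V W : rep A k)
    (f : forall x, V x) (g : forall x, W x) : generator f -> generator g ->
  (forall x, (f x == 0) = (g x == 0)) -> rep_iso V W.
Proof.
move=> gf gg fgE; have [F FE] := generator_hom gf gg fgE.
have [G GE] := generator_hom gg gf (fun x => esym (fgE x)).
exists F, G => x; split=> v.
- by have [a ->] := gf.2 x v; rewrite FE GE.
- by have [a ->] := gg.2 x v; rewrite GE FE.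
Qed.

Lemma supp_generator (R : realType) (A : quiver R) (k : fieldType) (V : rep A k)
    (f : forall x, V x) : generator f -> supp V = [set x | f x != 0].
Proof.
case=> _ gf; apply/seteqP; split=> x /=; last by exists (f x).
by case=> v; have [a ->] := gf x v; rewrite scaler_eq0 negb_or => /andP[].
Qed.

Lemma supp_iso (R : realType) (A : quiver R) (k : fieldType) (V W : rep A k) :
  rep_iso V W -> supp V = supp W.
Proof.
case=> F [G FG]; apply/seteqP; split=> x /= [v v0].
- exists (F x v); apply: contraNneq v0 => e; have [FK _] := FG x.
  by rewrite -(FK v) e linear0.
- exists (G x v); apply: contraNneq v0 => e; have [_ GK] := FG x.
  by rewrite -(GK v) e linear0.
Qed.

(** * The generator of an interval representation *)

Definition indic_one (k : fieldType) (b : bool) : indic_space k b :=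
  if b return indic_space k b then (1 : k^o) else 0.

Lemma indic_one_eq0 (k : fieldType) (b : bool) : (indic_one k b == 0) = ~~ b.
Proof. by case: b; rewrite /= ?eqxx // oner_eq0. Qed.

Lemma indic_one_gen (k : fieldType) (b : bool) (v : indic_space k b) :
  exists c, v = c *: indic_one k b.
Proof.
case: b v => v; first by exists v; rewrite /indic_one [RHS]mulr1.
by exists 0; rewrite [LHS]thinmx0 [RHS]thinmx0.
Qed.

Lemma indic_map_one (k : fieldType) (b c : bool) :
  b -> c -> indic_map k b c (indic_one k b) = indic_one k c.
Proof. by case: b; case: c. Qed.

Lemma interval_rep_generator (R : realType) (A : quiver R) (k : fieldType)
    (I : set R) (hI : real_interval I) :
  generator (V := interval_rep A k hI) (fun x => indic_one k (x \in I)).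
Proof.
split=> [x y yx|x v]; last exact: indic_one_gen.
by rewrite !indic_one_eq0 !negbK => Ix Iy; exact: indic_map_one.
Qed.

(** * Absence of accumulation points and local comparability *)

Lemma cvg_limit_point (R : realType) (S : set R) (u : R ^nat) (l : R) :
  (forall n, S (u n)) -> (forall n, u n != l) -> u @ \oo --> l -> limit_point S l.
Proof.
move=> Su ul ucvg U /ucvg[N _ NU]; exists (u N); split=> //; exact: NU (leqnn N).
Qed.

Lemma increasing_limit_point (R : realType) (S : set R) (u : R ^nat) (x : R) :
  (forall n, S (u n)) -> (forall n, u n < u n.+1) -> (forall n, u n <= x) ->
  limit_point S !=set0.
Proof.
move=> Su ui ux; have und : nondecreasing_seq u.
  by apply/nondecreasing_seqP => n; exact: ltW.
have ucv : cvgn u.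
  by apply: nondecreasing_is_cvgn => //; exists x => _ [n _ <-].
(* The limit is never attained: the next term would exceed it. *)
exists (limn u); apply: (cvg_limit_point Su _ ucv) => n; apply: contraTneq (ui n) => e.
by rewrite -leNgt e; exact: nondecreasing_cvgn_le.
Qed.

Lemma decreasing_limit_point (R : realType) (S : set R) (u : R ^nat) (x : R) :
  (forall n, S (u n)) -> (forall n, u n.+1 < u n) -> (forall n, x <= u n) ->
  limit_point S !=set0.
Proof.
move=> Su ui ux; have und : nonincreasing_seq u.
  by apply/nonincreasing_seqP => n; exact: ltW.
have ucv : cvgn u.
  by apply: nonincreasing_is_cvgn => //; exists x => _ [n _ <-].
exists (limn u); apply: (cvg_limit_point Su _ ucv) => n; apply: contraTneq (ui n) => e.
by rewrite -leNgt e; exact: nonincreasing_cvgn_ge.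
Qed.

Lemma node_lt (R : realType) (A : quiver R) (m n : \bar int) :
  indices A m -> indices A n -> (node A m < node A n)%E = (m < n)%E.
Proof. by move=> im i_n; rewrite !ltNge node_mono. Qed.

(** The point at plus infinity is a node of larger index, so convexity of the index set supplies
    [n + 1]. *)
Lemma indices_succ (R : realType) (A : quiver R) (n : int) :
  indices A n%:E -> (node A n%:E < +oo)%E -> indices A (n + 1)%:E.
Proof.
move=> i_n nx; have [m im my] : (node A @` indices A) +oo%E.
  by rewrite node_image; right; right.
have nm : (n%:E < m)%E by rewrite -(@node_lt _ A) // my.
apply: (indices_convex i_n im); first by rewrite lee_fin; lia.
by case: m nm {im my} => [m||] //; rewrite ?leey // lte_fin lee_fin; lia.
Qed.

Lemma indices_pred (R : realType) (A : quiver R) (n : int) :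
  indices A n%:E -> (-oo < node A n%:E)%E -> indices A (n - 1)%:E.
Proof.
move=> i_n nx; have [m im my] : (node A @` indices A) -oo%E.
  by rewrite node_image; right; left.
have nm : (m < n%:E)%E by rewrite -(@node_lt _ A) // my.
apply: (indices_convex im i_n); last by rewrite lee_fin; lia.
by case: m nm {im my} => [m||] //; rewrite ?leNye // lte_fin lee_fin; lia.
Qed.

Lemma node_fin (R : realType) (A : quiver R) (n : int) :
  indices A n%:E -> (-oo < node A n%:E < +oo)%E ->
  exists2 s, sinks_sources A s & node A n%:E = s%:E.
Proof.
move=> i_n /andP[nl nr].
have [[s Ss sE]|[nE|nE]] : sbar (sinks_sources A) (node A n%:E).
- by rewrite -node_image; exists n%:E.
- by exists s.
- by rewrite nE in nl.
- by rewrite nE in nr.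
Qed.

Lemma node_succ_lt (R : realType) (A : quiver R) (n : int) :
  indices A n%:E -> indices A (n + 1)%:E -> (node A n%:E < node A (n + 1)%:E)%E.
Proof. by move=> i0 i1; rewrite node_lt // lte_fin; lia. Qed.

(** Walk from the node of index 0 towards [x]. If no segment ever contains [x], the walk is an
    infinite strictly monotone sequence bounded by [x], which yields an accumulation point of
    [sinks_sources A]. *)
Lemma segment_right (R : realType) (A : quiver R) (x : R) :
  exists n : int, [/\ indices A n%:E, indices A (n + 1)%:E &
    (node A n%:E <= x%:E < node A (n + 1)%:E)%E].
Proof.
apply: contrapT => noseg; have := indices0 A; have [x0|x0] := leP (node A 0%:E) x%:E => i0.
- have H (n : nat) : indices A n%:Z%:E /\ (node A n%:Z%:E <= x%:E)%E.
    elim: n => [//|n [i_n nx]].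
    have i1 : indices A (n%:Z + 1)%:E.
      by apply: indices_succ => //; exact: le_lt_trans nx (ltry x).
    have -> : n.+1%:Z = n%:Z + 1 by lia.
    split=> //; rewrite leNgt; apply/negP => xn; apply: noseg.
    by exists n%:Z; rewrite nx xn.
  have Hlt (n : nat) : (node A n%:Z%:E < node A n.+1%:Z%:E)%E.
    by rewrite node_lt ?lte_fin; [lia|case: (H n)|case: (H n.+1)].
  (* The sequence starts at index 1, as the node of index 0 may be minus infinity; later nodes are
     finite. *)
  have Hs (n : nat) : exists s, sinks_sources A s /\ node A n.+1%:Z%:E = s%:E.
    have [i1 n1] := H n.+1; have [|s Ss sE] := node_fin i1; last by exists s.
    by rewrite (le_lt_trans n1 (ltry x)) (le_lt_trans (leNye _) (Hlt n)).
  have /choice[u uP] := Hs.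
  have [] := @increasing_limit_point R (sinks_sources A) u x; last first.
  + by move=> l; rewrite sinks_sources_no_limit.
  + by move=> n; rewrite -lee_fin -(uP n).2; case: (H n.+1).
  + by move=> n; rewrite -lte_fin -(uP n).2 -(uP n.+1).2.
  + by move=> n; case: (uP n).
- have H (n : nat) : indices A (- n%:Z)%:E /\ (x%:E < node A (- n%:Z)%:E)%E.
    elim: n => [//|n [i_n nx]].
    have i1 : indices A (- n%:Z - 1)%:E.
      by apply: indices_pred => //; exact: lt_trans (ltNyr x) nx.
    have -> : - n.+1%:Z = - n%:Z - 1 by lia.
    split=> //; rewrite ltNge; apply/negP => xn; apply: noseg.
    by exists (- n%:Z - 1); rewrite subrK xn.
  have Hlt (n : nat) : (node A (- n.+1%:Z)%:E < node A (- n%:Z)%:E)%E.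
    by rewrite node_lt ?lte_fin; [lia|case: (H n.+1)|case: (H n)].
  (* Likewise, the node of index 0 may be plus infinity, so the descending sequence starts at index
     -1. *)
  have Hs (n : nat) : exists s, sinks_sources A s /\ node A (- n.+1%:Z)%:E = s%:E.
    have [i1 n1] := H n.+1; have [|s Ss sE] := node_fin i1; last by exists s.
    by rewrite (lt_trans (ltNyr x) n1) (lt_le_trans (Hlt n) (leey _)).
  have /choice[u uP] := Hs.
  have [] := @decreasing_limit_point R (sinks_sources A) u x; last first.
  + by move=> l; rewrite sinks_sources_no_limit.
  + by move=> n; rewrite -lee_fin -(uP n).2 ltW //; case: (H n.+1).
  + by move=> n; rewrite -lte_fin -(uP n).2 -(uP n.+1).2.
  + by move=> n; case: (uP n).
Qed.

(** The segment from [segment_right] serves unless [x] is its left endpoint, in which case the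
    preceding segment does. *)
Lemma segment_left (R : realType) (A : quiver R) (x : R) :
  exists n : int, [/\ indices A n%:E, indices A (n + 1)%:E &
    (node A n%:E < x%:E <= node A (n + 1)%:E)%E].
Proof.
have [n [i0 i1 /andP[nx xn]]] := segment_right A x.
have [nlt|nge] := ltP (node A n%:E) x%:E; first by exists n; rewrite nlt ltW.
have i2 : indices A (n - 1)%:E.
  by apply: indices_pred => //; exact: lt_le_trans (ltNyr x) nge.
exists (n - 1); rewrite subrK; split=> //; rewrite nge andbT.
apply: lt_le_trans nx; rewrite -{2}(subrK 1 n).
by apply: node_succ_lt; rewrite // subrK.
Qed.

Lemma segment_comparable (R : realType) (A : quiver R) (n : int) (x y : R) :
  indices A n%:E -> indices A (n + 1)%:E ->
  (node A n%:E <= x%:E <= node A (n + 1)%:E)%E ->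
  (node A n%:E <= y%:E <= node A (n + 1)%:E)%E -> prec A x y \/ prec A y x.
Proof.
move=> i0 i1 xn yn.
have [h|h] : (if (2 %| n)%Z then x <= y else y <= x) \/
             (if (2 %| n)%Z then y <= x else x <= y).
- by case: ifP => _; case/orP: (le_total x y); auto.
- by left; right; exists n.
- by right; right; exists n.
Qed.

Lemma near_lte (R : realType) (x : R) (a : \bar R) :
  (a < x%:E)%E -> \forall y \near x, (a < y%:E)%E.
Proof.
case: a => [r||//]; last by move=> _; near=> y; exact: ltNyr.
by rewrite lte_fin; exact: lt_nbhsr.
Unshelve. all: by end_near. Qed.

Lemma near_gte (R : realType) (x : R) (a : \bar R) :
  (x%:E < a)%E -> \forall y \near x, (y%:E < a)%E.
Proof.
case: a => [r||//]; last by move=> _; near=> y; exact: ltry.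
by rewrite lte_fin; exact: lt_nbhsl.
Unshelve. all: by end_near. Qed.

(** Nearby points on the right share with [x] the segment from [segment_right], those on the left
    the one from [segment_left]. The two segments differ when [x] is a sink or a source. *)
Lemma near_comparable (R : realType) (A : quiver R) (x : R) :
  \forall y \near x, prec A x y \/ prec A y x.
Proof.
have [n [i0 i1 /andP[nx xn]]] := segment_right A x.
have [m [j0 j1 /andP[mx xm]]] := segment_left A x.
near=> y; have [xy|yx] := leP x y.
- have yn : (y%:E < node A (n + 1)%:E)%E by near: y; exact: near_gte.
  apply: (segment_comparable i0 i1); first by rewrite nx ltW.
  by rewrite (le_trans nx) ?lee_fin //= ltW.
- have my : (node A m%:E < y%:E)%E by near: y; exact: near_lte.
  apply: (segment_comparable j0 j1); first by rewrite (ltW mx).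
  by rewrite (ltW my) /= (le_trans _ xm) // lee_fin ltW.
Unshelve. all: by end_near. Qed.

(** * From connected support to indecomposability *)

Lemma connected_locally_constant (T : topologicalType) (I P : set T) :
  connected I -> (forall x, I x -> \forall y \near x, I y -> (P x <-> P y)) ->
  forall x y, I x -> I y -> P x -> P y.
Proof.
move=> cI Ploc x y Ix Iy Px.
suff IP : I `&` P = I by move: Iy; rewrite -IP => -[].
(* The part of [I] where [P] holds is clopen in [I]: it is the trace of an interior, and its
   complement in [I] is one too. The implications from [I] in both sets confine the conditions to
   points of [I]. *)
apply: cI; first by exists x.
- exists (interior [set z | I z -> P z]); first exact: open_interior.
  apply/seteqP; split=> z [Iz] => [Pz|/interior_subset]; last by split=> //; auto.
  by split=> //; near=> w => Iw; apply/(near (Ploc z Iz) w).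
- exists (~` interior [set z | I z -> ~ P z]); first exact/open_closedC/open_interior.
  apply/seteqP; split=> z [Iz] => [Pz|nz]; split=> //.
    by move=> /interior_subset; exact.
  apply: contrapT => nPz; apply: nz; near=> w => Iw Pw; apply: nPz.
  by apply/(near (Ploc z Iz) w).
Unshelve. all: by end_near. Qed.

Lemma pair_eq0 (k : fieldType) (U W : lmodType k) (p : (U * W)%type) :
  p.1 = 0 -> p.2 = 0 -> p = 0.
Proof. by case: p => a b /= -> ->. Qed.

Lemma generator_indecomposable (R : realType) (A : quiver R) (k : fieldType)
    (V : rep A k) (f : forall x, V x) : generator f ->
  real_interval [set x | f x != 0] -> indecomposable V.
Proof.
move=> [fc fg] [[x0 /= fx0] fconn]; split=> [z|V1 V2 [F [G FG]]].
  by rewrite (z x0 (f x0)) eqxx in fx0.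
have GK x w : F x (G x w) = w by case: (FG x).
have Fn0 x : f x != 0 -> F x (f x) != 0.
  by apply: contraNneq => e; have [FK _] := FG x; rewrite -(FK (f x)) e linear0.
have wE x (w : rep_sum V1 V2 x) : exists c, w = c *: F x (f x).
  by have [c cE] := fg x (G x w); exists c; rewrite -linearZ /= -cE GK.
(* Fibres of the sum are spanned by the transported generator, so maps between points of the support
   are injective. *)
have map_n0 x y (yx : prec A y x) (w : rep_sum V1 V2 x) : f x != 0 -> f y != 0 ->
    w != 0 -> rep_map (rep_sum V1 V2) yx w != 0.
  move=> fx fy w0; have [c cE] := wE x w; move: w0; rewrite cE linearZ /=.
  rewrite !scaler_eq0 !negb_or => /andP[-> _] /=.
  by have := hom_map_natural F yx (f x) => /= <-; rewrite fc // Fn0.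
(* Both [(v, 0)] and [(0, w)] are multiples of the transported generator. A nonzero [v] forces the
   second component of that generator to vanish, hence [w] too. *)
have excl x (v : V1 x) (w : V2 x) : v != 0 -> w = 0.
  move=> v0; have [c cE] := wE x (v, 0); have [d /(congr1 snd) /= ->] := wE x (0, w).
  move: v0; have /= -> := congr1 fst cE; rewrite scaler_eq0 negb_or => /andP[c0 _].
  have /= /esym/eqP := congr1 snd cE.
  by rewrite scaler_eq0 (negbTE c0) /= => /eqP ->; rewrite scaler0.
pose Z x := forall v : V1 x, v = 0.
have ZP x y : f x != 0 -> f y != 0 -> prec A y x -> Z x <-> Z y.
  move=> fx fy yx; split=> z v.
  (* If [V1 x] is zero, the generator at [x] lies in [V2 x] and has nonzero image in [V2 y], which
     by [excl] leaves no nonzero vector in [V1 y]. *)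
  - have q0 : ((0, (F x (f x)).2) : rep_sum V1 V2 x) != 0.
      apply: contraNneq (Fn0 x fx) => /(congr1 snd) /= q0.
      by apply/eqP; apply: pair_eq0; [exact: z|exact: q0].
    apply/eqP; apply: contraNT (map_n0 x y yx _ fx fy q0) => v0.
    by apply/eqP; apply: pair_eq0; [exact: linear0|exact: excl v0].
  - apply/eqP; apply: contraPT (z (rep_map V1 yx v)) => v0 e.
    have v00 : ((v, 0) : rep_sum V1 V2 x) != 0 by apply: contraNneq v0 => /(congr1 fst) /= ->.
    have /eqP := map_n0 x y yx _ fx fy v00; apply.
    by apply: pair_eq0; [exact: e|exact: linear0].
have Zconst x y : f x != 0 -> f y != 0 -> Z x -> Z y.
  move=> fx fy; apply: (connected_locally_constant fconn) => // {x fx y fy} x /= fx.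
  near=> y => fy; have [xy|yx] : prec A x y \/ prec A y x by near: y; exact: near_comparable.
  - by apply: iff_sym; exact: ZP.
  - exact: ZP.
have out x v w : f x = 0 -> v = 0 :> V1 x /\ w = 0 :> V2 x.
  move=> fx; have [c] := wE x (v, w); rewrite fx linear0 scaler0 => e.
  by split; [exact: (congr1 fst e)|exact: (congr1 snd e)].
have [z0|nz0] := pselect (Z x0); [left|right] => x v.
  have [fx|fx] := eqVneq (f x) 0; first by case: (out x v 0 fx).
  exact: (Zconst x0 x fx0 fx z0).
have [fx|fx] := eqVneq (f x) 0; first by case: (out x 0 v fx).
(* A nonzero [v] in [V2 x] would make [V1 x] zero by [excl], hence also [V1 x0] by [Zconst]. *)
apply: contrapT => v0; apply: nz0; apply: (Zconst x x0) => // u.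
by apply: contrapT => /eqP u0; apply: v0; exact: excl u0.
Unshelve. all: by end_near. Qed.

(** * Classification by the support *)

Lemma indecomposable_interval (R : realType) (A : quiver R) (k : fieldType)
    (V : rep A k) : pointwise_one_dim V -> indecomposable V ->
  exists2 f : forall x, V x, generator f & real_interval [set x | f x != 0].
Proof.
move=> V1 Vi; have [f [fJ _] gf] := indecomposable_generator V1 Vi.
exists f => //; split; last exact/connected_intervalP/btw_closed_interval.
apply: contrapT => f0; apply: Vi.1 => x v; have [c ->] := gf.2 x v.
have [->|fx] := eqVneq (f x) 0; first by rewrite scaler0.
by case: f0; exists x.
Qed.

Theorem theorem1 (R : realType) (A : quiver R) (k : fieldType) :
  (forall (I : set R) (hI : real_interval I),
      indecomposable (interval_rep A k hI)) /\
  (forall V : rep A k, pointwise_one_dim V -> indecomposable V ->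
      exists (I : set R) (hI : real_interval I),
        rep_iso V (interval_rep A k hI)) /\
  (forall V V' : rep A k,
      pointwise_one_dim V -> indecomposable V ->
      pointwise_one_dim V' -> indecomposable V' ->
      (rep_iso V V' <-> supp V = supp V')).
Proof.
split; [|split].
- move=> I hI; apply: (generator_indecomposable (interval_rep_generator A k hI)).
  suff -> : [set x | indic_one k (x \in I) != 0] = I by [].
  by apply/seteqP; split=> x /=; rewrite indic_one_eq0 negbK inE.
- move=> V V1 Vi; have [f gf hI] := indecomposable_interval V1 Vi.
  exists [set x | f x != 0], hI.
  apply: (generator_iso gf (interval_rep_generator A k hI)) => x.
  rewrite indic_one_eq0; apply/idP/idP => [fx|].
  + by apply/negP; rewrite inE /= fx.
  + by apply: contraNT => fx; rewrite inE.
- move=> V V' V1 Vi V1' Vi'; split=> [|sE]; first exact: supp_iso.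
  have [f gf _] := indecomposable_interval V1 Vi.
  have [g gg _] := indecomposable_interval V1' Vi'.
  move: sE; rewrite (supp_generator gf) (supp_generator gg) => /seteqP[fg gf'].
  apply: (generator_iso gf gg) => x; apply/idP/idP; apply: contraTT.
  + exact: gf'.
  + exact: fg.
Qed.
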